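(* Let $0<\mu<L<\infty$, $\sigma\ge0$ and $f\in\mathcal S_{\mu,L}$, with global minimizer $x^\star$. Choose $$0<\tilde\alpha\le\frac1{1+\sigma^2}\sqrt{\frac\mu L},\qquad \alpha=\frac{\tilde\alpha}{1-\tilde\alpha},\qquad \beta=\frac{\tilde\alpha}{\mu/(1+\sigma^2)}.$$ Starting from $x_0=v_0\in\mathbb R^d$, let $(x_k,v_k)_{k\ge0}$ be generated by the SHANG++ recursion $$\frac{x_{k+1}-x_k^+}{\tilde\alpha}=v_k-x_{k+1},\qquad \frac{v_{k+1}-v_k}{\alpha}=x_{k+1}-v_{k+1}-\frac1\mu g(x_{k+1}),\qquad x_{k}^+=x_{k}-\tilde\alpha\beta\, g(x_{k})\quad(k\ge0),$$ where the stochastic gradients are conditionally unbiased and satisfy the multiplicative noise scaling (MNS) condition with constant $\sigma$. Then for all $k\ge0$, $$\mathbb E\Big[f(x_{k+1}^+)-f(x^\star)+\frac\mu2\|v_{k+1}-x^\star\|^2\Big]\le(1-\tilde\alpha)^{k+1}\,\mathbb E\Big[f(x_0^+)-f(x^\star)+\frac\mu2\|v_0-x^\star\|^2\Big].$$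
   Context: $\langle\cdot,\cdot\rangle$ and $\|\cdot\|$ are the Euclidean inner product and norm on $\mathbb R^d$. For differentiable $f:\mathbb R^d\to\mathbb R$, let $D_f(y,x)=f(y)-f(x)-\langle\nabla f(x),y-x\rangle$. $\mathcal S_{\mu,L}$ is the class of differentiable $f:\mathbb R^d\to\mathbb R$ that are $\mu$-strongly convex, i.e. $D_f(y,x)\ge\frac\mu2\|y-x\|^2$ for all $x,y$, and $L$-smooth, i.e. $\|\nabla f(y)-\nabla f(x)\|\le L\|y-x\|$ for all $x,y$. $x^\star$ denotes the global minimizer of $f$. Stochastic gradients: all random objects live on a complete probability space. For each $k\ge0$, $g(x_k)$ is a random vector in $\mathbb R^d$ (one sample per index $k$; the same sample $g(x_k)$ is used wherever it appears). $\mathcal F_k$ is the $\sigma$-algebra of information available before sampling $g(x_k)$, i.e. generated by the initial data and $g(x_0),\dots,g(x_{k-1})$; thus $x_k$ is $\mathcal F_k$-measurable. In the recursion, $x_k^+$, $x_{k+1}$ and $v_k$ are determined before $g(x_{k+1})$ is sampled and are $\mathcal F_{k+1}$-measurable. Conditional unbiasedness means $\mathbb E[g(x_k)\mid\mathcal F_k]=\nabla f(x_k)$ for all $k\ge0$. The MNS condition with constant $\sigma\ge0$ means $\mathbb E[\|g(x_k)-\nabla f(x_k)\|^2\mid\mathcal F_k]\le\sigma^2\|\nabla f(x_k)\|^2$ for all $k\ge0$. *)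

(* Defs.v *)
From HB Require Import structures.
From mathcomp Require Import all_boot all_order all_algebra.
From mathcomp Require Import all_classical all_reals all_analysis.
From mathcomp Require Import measurable_realfun.

Set Implicit Arguments.
Unset Strict Implicit.
Unset Printing Implicit Defensive.

Import Order.TTheory GRing.Theory Num.Theory.
Import numFieldNormedType.Exports.

Local Open Scope classical_set_scope.
Local Open Scope ring_scope.

Definition dotp (R : realType) (d : nat) (u v : 'rV[R]_d) : R :=
  \sum_(i < d) u ord0 i * v ord0 i.

(* The library's norm `|u| on 'rV[R]_d is the sup norm; it induces the same
   topology and the same notion of differentiability as enorm. *)
Definition enorm (R : realType) (d : nat) (u : 'rV[R]_d) : R :=
  Num.sqrt (dotp u u).

Definition grad (R : realType) (d : nat) (f : 'rV[R]_d -> R) (x : 'rV[R]_d) :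
    'rV[R]_d :=
  \row_(i < d) 'D_(delta_mx ord0 i) f x.

Definition bregman (R : realType) (d : nat) (f : 'rV[R]_d -> R)
    (y x : 'rV[R]_d) : R :=
  f y - f x - dotp (grad f x) (y - x).

Record strongly_convex_smooth (R : realType) (d : nat) (mu L : R)
    (f : 'rV[R]_d -> R) : Prop := {
  scs_differentiable : forall x, differentiable f x ;
  scs_strongly_convex : forall x y,
    mu / 2 * enorm (y - x) ^+ 2 <= bregman f y x ;
  scs_smooth : forall x y,
    enorm (grad f y - grad f x) <= L * enorm (y - x) }.

Definition borel_rV (R : realType) (d : nat) : set (set 'rV[R]_d) :=
  <<s [set U : set 'rV[R]_d | open U] >>.

Definition sigma_of (R : realType) (d : nat) (T : Type) (X : T -> 'rV[R]_d) :
    set (set T) :=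
  preimage_set_system [set: T] X (@borel_rV R d).

Definition random_vector (R : realType) (d : nat) (disp : measure_display)
    (T : measurableType disp) (X : T -> 'rV[R]_d) : Prop :=
  sigma_of X `<=` measurable.

Definition history (R : realType) (d : nat) (T : Type) (x0 : T -> 'rV[R]_d)
    (g : nat -> T -> 'rV[R]_d) (k : nat) : set (set T) :=
  <<s sigma_of x0 `|` \bigcup_(j in [set j | (j < k)%N]) sigma_of (g j) >>.

(* Y is a version of E[X | F].  Meaningful for X integrable, or X measurable
   and nonnegative; in the latter case the integrals may be +oo. *)
Definition is_condexp (R : realType) (disp : measure_display)
    (T : measurableType disp) (P : probability T R) (F : set (set T))
    (X Y : T -> \bar R) : Prop :=
  (forall B : set (\bar R), measurable B -> F (Y @^-1` B)) /\
  forall A : set T, F A ->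
    (\int[P]_(w in A) Y w = \int[P]_(w in A) X w)%E.

Definition unbiased_gradients (R : realType) (d : nat)
    (disp : measure_display) (T : measurableType disp) (P : probability T R)
    (f : 'rV[R]_d -> R) (x g : nat -> T -> 'rV[R]_d) : Prop :=
  forall (k : nat) (i : 'I_d),
    P.-integrable [set: T] (fun w => (g k w ord0 i)%:E) /\
    is_condexp P (history (x 0%N) g k) (fun w => (g k w ord0 i)%:E)
      (fun w => (grad f (x k w) ord0 i)%:E).

Definition mns (R : realType) (d : nat) (disp : measure_display)
    (T : measurableType disp) (P : probability T R) (sigma : R)
    (f : 'rV[R]_d -> R) (x g : nat -> T -> 'rV[R]_d) : Prop :=
  forall k : nat, exists2 Y : T -> \bar R,
    is_condexp P (history (x 0%N) g k)
      (fun w => (enorm (g k w - grad f (x k w)) ^+ 2)%:E) Y &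
    {ae P, forall w,
      (Y w <= (sigma ^+ 2 * enorm (grad f (x k w)) ^+ 2)%:E)%E}.

(* g k is the sample g(x_k), xp k is x_k^+ and ta is \tilde\alpha. *)
Record shangpp (R : realType) (d : nat) (T : Type) (mu ta alpha beta : R)
    (g x xp v : nat -> T -> 'rV[R]_d) : Prop := {
  shangpp_init : forall w, x 0%N w = v 0%N w ;
  shangpp_x : forall k w,
    ta^-1 *: (x k.+1 w - xp k w) = v k w - x k.+1 w ;
  shangpp_v : forall k w,
    alpha^-1 *: (v k.+1 w - v k w)
      = x k.+1 w - v k.+1 w - mu^-1 *: g k.+1 w ;
  shangpp_xp : forall k w, xp k w = x k w - (ta * beta) *: g k w }.

(* Main.v *)
Require Import Defs.
From HB Require Import structures.
From mathcomp Require Import all_boot all_order all_algebra.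
From mathcomp Require Import all_classical all_reals all_analysis.
From mathcomp Require Import measurable_realfun ring lra.
Set Implicit Arguments.
Unset Strict Implicit.
Unset Printing Implicit Defensive.
Import Order.TTheory GRing.Theory Num.Theory.
Import numFieldNormedType.Exports.
Import HBSimple HBNNSimple.
Local Open Scope classical_set_scope.
Local Open Scope ring_scope.

(** The Lyapunov function
      V_k = f(x_k^+) - f(x* ) + mu/2 |v_k - x*|^2
    contracts by the factor 1 - ta in expectation at every step.

    Write y = x_{k+1}, G = grad f(y), n = g(y) - G for the noise, s = sigma^2
    and eta = ta * beta = ta^2 (1 + s) / mu for the gradient step.  The
    recursion says y - x_k^+ = ta (v_k - y) and
    v_{k+1} = (1 - ta) v_k + ta y - (ta/mu) g(y).  Expanding the square,
    bounding f(x_{k+1}^+) by L-smoothness at y, and using strong convexity from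
    y to x* (weight ta) and convexity from y to x_k^+ (weight 1 - ta) gives,
    for every outcome,
      V_{k+1} <= (1 - ta) V_k + (ta^2/mu) (|n|^2 - s |G|^2) + <n, W>,
    where W is an explicit combination of G, y - x* and v_k - y
    ([lyapunov_step]).  The bound on ta enters only as eta (1 + s) L <= 1: it
    makes the two |g|^2 terms, one from smoothness and one from the square,
    at most eta/(1 + s) = ta^2/mu in total.

    In expectation the noise terms are harmless.  MNS gives E|n|^2 <= s E|G|^2
    ([noise_le]), and E<n, W> = 0 because W is known before g(y) is sampled
    while n has conditional mean zero ([noise_orthogonal]).  The latter needs
    |G|^2 and |W|^2 to be integrable; both are bounded by a constant multiple
    of V_k by strong convexity ([lyapunov_dominates]), so integrability
    propagates along the induction together with the estimate
    ([lyapunov_contraction]).  If E V_0 is infinite, the right-hand side of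
    the theorem is +oo because 1 - ta > 0. *)

(** * The Euclidean inner product *)

Section EuclideanAlgebra.
Context (R : realType) (d : nat).
Implicit Types (u v w : 'rV[R]_d) (c : R).

Lemma dotpC u v : dotp u v = dotp v u.
Proof. by apply: eq_bigr => i _; rewrite mulrC. Qed.

Lemma dotpDl u v w : dotp (u + v) w = dotp u w + dotp v w.
Proof. by rewrite -big_split; apply: eq_bigr => i _; rewrite mxE mulrDl. Qed.

Lemma dotpZl c u v : dotp (c *: u) v = c * dotp u v.
Proof. by rewrite /dotp mulr_sumr; apply: eq_bigr => i _; rewrite mxE mulrA. Qed.

Lemma dotpNl u v : dotp (- u) v = - dotp u v.
Proof. by rewrite -scaleN1r dotpZl mulN1r. Qed.

Lemma dotpDr u v w : dotp u (v + w) = dotp u v + dotp u w.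
Proof. by rewrite dotpC dotpDl !(dotpC u). Qed.

Lemma dotpZr c u v : dotp u (c *: v) = c * dotp u v.
Proof. by rewrite dotpC dotpZl dotpC. Qed.

Lemma dotpNr u v : dotp u (- v) = - dotp u v.
Proof. by rewrite dotpC dotpNl dotpC. Qed.

Definition dotpE := (dotpDl, dotpDr, dotpNl, dotpNr, dotpZl, dotpZr).

Lemma dotp_ge0 u : 0 <= dotp u u.
Proof. by apply: sumr_ge0 => i _; rewrite -expr2 sqr_ge0. Qed.

Lemma sqr_enorm u : enorm u ^+ 2 = dotp u u.
Proof. by rewrite /enorm sqr_sqrtr // dotp_ge0. Qed.

Lemma enorm_ge0 u : 0 <= enorm u. Proof. exact: sqrtr_ge0. Qed.

Lemma dotp_eq0 u : dotp u u <= 0 -> u = 0.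
Proof.
move=> u0; have /eqP := @le_anti _ _ _ _ (introT andP (conj u0 (dotp_ge0 u))).
rewrite psumr_eq0 => [/allP h|i _]; last by rewrite -expr2 sqr_ge0.
apply/rowP => i; rewrite mxE.
by have := h i (mem_index_enum i); rewrite mulf_eq0 orbb => /eqP.
Qed.

(** Young's inequality, from |u - c v|^2 >= 0; it stands in for
    Cauchy-Schwarz in the descent lemma. *)
Lemma dotp_le_sqr u v c : 0 < c ->
  dotp u v <= dotp u u / (2 * c) + c / 2 * dotp v v.
Proof.
move=> c0; have := dotp_ge0 (u - c *: v).
rewrite !dotpE (dotpC v u) => h.
rewrite -subr_ge0.
have -> : dotp u u / (2 * c) + c / 2 * dotp v v - dotp u v =
  (dotp u u + - (c * dotp u v) + (- (c * dotp u v) - (- (c * (c * dotp v v))))) / (2 * c).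
  by field; lra.
by rewrite divr_ge0 //; lra.
Qed.

End EuclideanAlgebra.

(** * Smooth strongly convex functions *)

Section SmoothConvex.
Context (R : realType) (d : nat) (mu L : R) (f : 'rV[R]_d -> R).
Hypotheses (mu_gt0 : 0 < mu) (L_gt0 : 0 < L)
  (f_class : strongly_convex_smooth mu L f).

Lemma strong_convexity x y :
  f x + dotp (grad f x) (y - x) + mu / 2 * dotp (y - x) (y - x) <= f y.
Proof.
by have := scs_strongly_convex f_class x y; rewrite /bregman sqr_enorm; lra.
Qed.

Lemma convexity x y : f x + dotp (grad f x) (y - x) <= f y.
Proof.
apply: le_trans (strong_convexity x y).
by rewrite lerDl mulr_ge0 ?dotp_ge0 // divr_ge0 // ltW.
Qed.

Lemma smooth_sqr x y : dotp (grad f y - grad f x) (grad f y - grad f x)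
  <= L ^+ 2 * dotp (y - x) (y - x).
Proof.
rewrite -!sqr_enorm -exprMn ler_pXn2r ?nnegrE ?enorm_ge0 //.
  exact: scs_smooth f_class x y.
by rewrite mulr_ge0 ?enorm_ge0 // ltW.
Qed.

(** By convexity at the far endpoint x + t u, the increment over a step of
    length h is at most h <grad f(x + t u), u>, and the Lipschitz bound moves
    the gradient back to x. *)
Lemma convex_increment x u t h : 0 <= h -> 0 < t ->
  f (x + t *: u) - f (x + (t - h) *: u)
  <= h * dotp (grad f x) u + h * (L * t) * dotp u u.
Proof.
move=> h0 t0.
have := convexity (x + t *: u) (x + (t - h) *: u).
have -> : x + (t - h) *: u - (x + t *: u) = - h *: u.
  by rewrite scalerBl scaleNr opprD addrACA subrr add0r addrAC subrr add0r.
have := smooth_sqr x (x + t *: u); rewrite [x + _ - x]addrAC subrr add0r.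
set G := grad f x; set G' := grad f _; rewrite dotpZl 2!dotpZr => sm cv.
have h1 : dotp (G' - G) (G' - G) / (2 * (L * t)) <= L * t / 2 * dotp u u.
  rewrite ler_pdivrMr ?mulr_gt0 //.
  by apply: le_trans sm _; rewrite le_eqVlt; apply/orP; left; apply/eqP; field.
have h2 : dotp G' u - dotp G u <= L * t * dotp u u.
  rewrite -dotpNl -dotpDl.
  apply: le_trans (@dotp_le_sqr _ _ (G' - G) u (L * t) (mulr_gt0 L_gt0 t0)) _.
  by lra.
have : h * (dotp G' u - dotp G u) <= h * (L * t * dotp u u).
  exact: ler_wpM2l.
move: cv; lra.
Qed.

(** Summing [convex_increment] over n steps of length 1/n along the segment
    gives the quadratic upper bound up to the factor 1 + 1/n; then n is taken
    large.  Convexity replaces integration of the derivative along the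
    segment. *)
Lemma descent x u :
  f (x + u) <= f x + dotp (grad f x) u + L / 2 * dotp u u.
Proof.
have step n m : (0 < n)%N -> f (x + (m%:R / n%:R) *: u) <=
    f x + m%:R / n%:R * dotp (grad f x) u
    + L * (m%:R * (m%:R + 1)) / (2 * n%:R ^+ 2) * dotp u u.
  move=> n0; have n0' : (n%:R : R) != 0 by rewrite pnatr_eq0 -lt0n.
  elim: m => [|m IH]; first by rewrite !mul0r scale0r !mulr0 !mul0r !addr0.
  have h0 : 0 <= (n%:R : R)^-1 by rewrite invr_ge0 ler0n.
  have t0 : 0 < (m.+1%:R / n%:R : R) by rewrite divr_gt0 ?ltr0n.
  have := @convex_increment x u _ _ h0 t0.
  have -> : m.+1%:R / n%:R - n%:R^-1 = m%:R / n%:R :> R.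
    by rewrite -natr1; field.
  have -> : L * (m.+1%:R * (m.+1%:R + 1)) / (2 * n%:R ^+ 2) * dotp u u =
     L * (m%:R * (m%:R + 1)) / (2 * n%:R ^+ 2) * dotp u u
     + n%:R^-1 * (L * (m.+1%:R / n%:R)) * dotp u u.
    by rewrite -natr1; field.
  have -> : m.+1%:R / n%:R = m%:R / n%:R + n%:R^-1 :> R.
    by rewrite -natr1; field.
  rewrite (mulrDl (m%:R / n%:R)); lra.
apply/ler_addgt0Pr => e e0.
pose K := L / 2 * dotp u u.
have K0 : 0 <= K by rewrite mulr_ge0 ?dotp_ge0 // divr_ge0 // ltW.
(* The excess over the limit is K / n, so n > K / e makes it at most e. *)
pose n := (Num.truncn (K / e)).+1.
have nK : K / e < n%:R by exact: truncnS_gt.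
have := step n n isT.
have n0 : (n%:R : R) != 0 by rewrite pnatr_eq0.
rewrite divff // scale1r mul1r => /le_trans; apply.
rewrite -[leRHS]addrA lerD2l.
have -> : L * (n%:R * (n%:R + 1)) / (2 * n%:R ^+ 2) * dotp u u = K + K / n%:R.
  by rewrite /K; field.
rewrite lerD2l ler_pdivrMr ?ltr0n // mulrC -ler_pdivrMr //; exact: ltW.
Qed.

(** A gradient step of length 1/L from xs would decrease f by
    |grad f xs|^2 / (2 L). *)
Lemma grad_minimizer xs : (forall y, f xs <= f y) -> grad f xs = 0.
Proof.
move=> min; apply: dotp_eq0.
have := min (xs + (- L^-1) *: grad f xs).
have := descent xs (- L^-1 *: grad f xs).
rewrite !dotpE; set D := dotp _ _.
have -> : L / 2 * (- L^-1 * (- L^-1 * D)) = L^-1 * D / 2 by field; exact: lt0r_neq0.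
move=> h1 h2; have : L^-1 * D <= 0 by lra.
by rewrite pmulr_rle0 // invr_gt0.
Qed.

Lemma quadratic_growth (xs p : 'rV[R]_d) : (forall y, f xs <= f y) ->
  mu / 2 * dotp (p - xs) (p - xs) <= f p - f xs.
Proof.
move=> min; have := strong_convexity xs p.
by rewrite (grad_minimizer min) -(scale0r 0) dotpZl mul0r; lra.
Qed.

End SmoothConvex.

(** * The one-step inequality *)

(** The inequality behind the theorem before any expectation is taken, for an
    arbitrary vector g in place of the sampled gradient: y, p, v stand for
    x_{k+1}, x_k^+, v_k.  On the right, the terms in g - G are arranged so
    that MNS controls the quadratic one and unbiasedness kills the linear
    one. *)
Lemma lyapunov_step (R : realType) (d : nat) (mu L s ta : R)
    (f : 'rV[R]_d -> R) (xs p v y g G : 'rV[R]_d) :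
  0 < mu -> 0 < L -> strongly_convex_smooth mu L f ->
  0 < ta -> ta <= 1 -> ta ^+ 2 * (1 + s) ^+ 2 * L <= mu ->
  (forall z, f xs <= f z) ->
  y - p = ta *: (v - y) ->
  G = grad f y ->
  f (y - (ta ^+ 2 / mu * (1 + s)) *: g) - f xs
    + mu / 2 * dotp ((1 - ta) *: v + ta *: y - (ta / mu) *: g - xs)
                    ((1 - ta) *: v + ta *: y - (ta / mu) *: g - xs)
  <= (1 - ta) * (f p - f xs + mu / 2 * dotp (v - xs) (v - xs))
     + ta ^+ 2 / mu * (dotp (g - G) (g - G) - s * dotp G G)
     + dotp (g - G) ((ta ^+ 2 / mu * (1 - s)) *: G
                     - ta *: (y - xs + (1 - ta) *: (v - y))).
Proof.
move=> mu_gt0 L_gt0 f_class ta_gt0 ta_le1 taL min yp defG.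
have mu_neq0 : mu != 0 by rewrite gt_eqF.
(* With ta = mu * k every coefficient below is polynomial in mu, k, s, L. *)
have [k taE] : exists k, ta = mu * k by exists (ta / mu); field.
have -> : ta ^+ 2 / mu = mu * k ^+ 2 by rewrite taE; field.
have -> : ta / mu = k by rewrite taE; field.
have kL : mu * k ^+ 2 * (1 + s) ^+ 2 * L <= 1.
  by rewrite -(ler_pM2l mu_gt0) mulr1; move: taL; rewrite taE; lra.
set eta := mu * k ^+ 2 * (1 + s).
have ta0 : 0 <= ta by exact: ltW.
have ds := descent mu_gt0 L_gt0 f_class y (- (eta *: g)).
rewrite -defG in ds.
have := strong_convexity f_class y xs; rewrite -defG => sc.
have := convexity mu_gt0 f_class y p; rewrite -defG => cv.
set a := v - y in yp *; set b := y - xs.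
have Exs : xs - y = - b by rewrite opprB.
have Ep : p - y = - (ta *: a) by rewrite -opprB yp.
have Ev : v - xs = a + b by rewrite addrA subrK.
have Ev' : (1 - ta) *: v + ta *: y - k *: g - xs = (1 - ta) *: a + b - k *: g.
  by apply/rowP => i; rewrite !mxE; ring.
rewrite Exs in sc; rewrite Ep in cv; rewrite Ev Ev'. clearbody a b.
have := dotp_ge0 g; have := dotp_ge0 a.
have := ler_wpM2l ta0 sc.
have : 0 <= 1 - ta by rewrite subr_ge0.
move=> ta1; have := ler_wpM2l ta1 cv.
move: ds; rewrite !dotpE (dotpC b a) ?(dotpC b g) ?(dotpC a g) ?(dotpC g G)
  ?(dotpC a G) ?(dotpC b G).
set gg := dotp g g; set aa := dotp a a; set bb := dotp b b.
move=> ds h1 h2 aa0 gg0.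
(* The square of the convex combination (1 - ta) v + ta y leaves this term
   over, with a favourable sign. *)
have : 0 <= ta * (1 - ta) * mu * aa.
  by rewrite !mulr_ge0 // ltW.
(* Smoothness contributes L eta^2 / 2 to the coefficient of |g|^2; the step
   size bound makes it at most mu k^2 / 2. *)
have : mu * k ^+ 2 * (mu * k ^+ 2 * (1 + s) ^+ 2 * L) * gg <= mu * k ^+ 2 * gg.
  by rewrite ler_wpM2r // ler_piMr // mulr_ge0 ?sqr_ge0 // ltW.
move: ds h1 h2; rewrite /eta taE; lra.
Qed.


Section Domination.
Context (R : realType) (d : nat).
Implicit Types (u v : 'rV[R]_d).

Lemma dotpDD_le u v : dotp (u + v) (u + v) <= 2 * dotp u u + 2 * dotp v v.
Proof.
have := dotp_ge0 (u - v); rewrite !dotpE (dotpC v u); lra.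
Qed.

Lemma dotpBB_le u v : dotp (u - v) (u - v) <= 2 * dotp u u + 2 * dotp v v.
Proof.
have := dotpDD_le u (- v); rewrite (dotpNl v) dotpNr; lra.
Qed.

Variables (mu L : R) (f : 'rV[R]_d -> R) (ta c1 c2 : R).
Hypotheses (mu_gt0 : 0 < mu) (L_gt0 : 0 < L)
  (f_class : strongly_convex_smooth mu L f) (ta0 : 0 <= ta) (ta1 : ta <= 1).

(** Strong convexity bounds |p - xs|^2 and |v - xs|^2 by multiples of the
    Lyapunov function, and y is a convex combination of p and v; the gradient
    at y is then controlled by its Lipschitz constant, since it vanishes at
    xs.  This provides the square integrability that the orthogonality of the
    noise requires. *)
Lemma lyapunov_dominates : exists2 C : R, 0 <= C &
  forall xs p v y : 'rV[R]_d, (forall z, f xs <= f z) ->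
  y - p = ta *: (v - y) ->
  let V := f p - f xs + mu / 2 * dotp (v - xs) (v - xs) in
  let W := c1 *: grad f y - ta *: (y - xs + c2 *: (v - y)) in
  (dotp (grad f y) (grad f y) <= C * V) /\ (dotp W W <= C * V).
Proof.
pose CG := L ^+ 2 * (8 / mu).
pose CW := 2 * c1 ^+ 2 * CG + 2 * ta ^+ 2 * (2 * (8 / mu) + 2 * c2 ^+ 2 * (20 / mu)).
have CG0 : 0 <= CG by rewrite mulr_ge0 ?sqr_ge0 // divr_ge0 // ltW.
have mu0 : 0 <= mu^-1 by rewrite invr_ge0 ltW.
have CW0 : 0 <= CW.
  by rewrite /CW; do ![exact: CG0 | exact: sqr_ge0 | exact: mu0 | done
    | apply: mulr_ge0 | apply: addr_ge0].
exists (CG + CW); first exact: addr_ge0.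
move=> xs p v y min yp V W.
have qg := quadratic_growth mu_gt0 L_gt0 f_class p min.
have pV : mu / 2 * dotp (p - xs) (p - xs) <= V.
  by apply: le_trans qg _; rewrite lerDl mulr_ge0 ?dotp_ge0 // divr_ge0 // ltW.
have vV : mu / 2 * dotp (v - xs) (v - xs) <= V.
  by rewrite lerDr subr_ge0.
have V0 : 0 <= V.
  by apply: le_trans vV; rewrite mulr_ge0 ?dotp_ge0 // divr_ge0 // ltW.
have scale D : mu / 2 * D <= V -> D <= 2 / mu * V.
  by move=> h; rewrite -ler_pdivrMl ?divr_gt0 // invf_div.
move: pV vV => /scale pV /scale vV.
(* (1 + ta) (y - xs) is the sum of p - xs and ta (v - xs), each bounded by
   2 / mu * V. *)
have bV : dotp (y - xs) (y - xs) <= 8 / mu * V.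
  have bE : (1 + ta) *: (y - xs) = (p - xs) + ta *: (v - xs).
    apply/rowP => i; move/rowP : yp => /(_ i); rewrite !mxE; lra.
  have := dotpDD_le (p - xs) (ta *: (v - xs)).
  rewrite -bE !dotpZl !dotpZr => h.
  have h1 : ta * (ta * dotp (v - xs) (v - xs)) <= dotp (v - xs) (v - xs).
    by rewrite mulrA ler_piMl ?dotp_ge0 // mulr_ile1.
  have h2 : dotp (y - xs) (y - xs) <= (1 + ta) * ((1 + ta) * dotp (y - xs) (y - xs)).
    rewrite mulrA ler_peMl ?dotp_ge0 //.
    have := ta0; nra.
  lra.
have aV : dotp (v - y) (v - y) <= 20 / mu * V.
  have -> : v - y = (v - xs) - (y - xs) by rewrite opprB addrA subrK.
  have := dotpBB_le (v - xs) (y - xs); lra.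
have gV : dotp (grad f y) (grad f y) <= CG * V.
  have := smooth_sqr L_gt0 f_class xs y.
  rewrite (grad_minimizer mu_gt0 L_gt0 f_class min) subr0 => /le_trans; apply.
  by rewrite /CG -mulrA ler_wpM2l ?sqr_ge0.
have wV : dotp W W <= CW * V.
  have := dotpBB_le (c1 *: grad f y) (ta *: (y - xs + c2 *: (v - y))).
  have := dotpDD_le (y - xs) (c2 *: (v - y)).
  rewrite -/W !(dotpZl, dotpZr) => h1 h2.
  have k1 := ler_wpM2l (sqr_ge0 c1) gV.
  have k2 := ler_wpM2l (sqr_ge0 c2) aV.
  have k3 : dotp (y - xs + c2 *: (v - y)) (y - xs + c2 *: (v - y)) <=
    2 * (8 / mu * V) + 2 * (c2 ^+ 2 * (20 / mu * V)) by lra.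
  have k4 := ler_wpM2l (sqr_ge0 ta) k3.
  rewrite /CW; lra.
split.
  by apply: le_trans gV _; rewrite ler_wpM2r // lerDl.
by apply: le_trans wV _; rewrite ler_wpM2r // lerDr.
Qed.

End Domination.

(** * Orthogonality of a conditionally centered variable *)

Section Orthogonality.
Context (R : realType) (disp : measure_display) (T : measurableType disp)
  (P : probability T R) (G : set (set T)).
Hypothesis GM : <<s G >> `<=` measurable.

Lemma measurable_fun_coarse (d' : measure_display) (U : measurableType d')
    (f : T -> U) :
  measurable_fun [set: g_sigma_algebraType G] f ->
  measurable_fun [set: T] f.
Proof. by move=> mf _ Y mY; apply: GM; exact: mf. Qed.

Section CenteredNoise.
Variable h : T -> R.
Hypotheses (ih : P.-integrable [set: T] (EFin \o h))
  (h0 : forall A, <<s G >> A -> (\int[P]_(w in A) (h w)%:E = 0)%E).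

Let mh : measurable_fun [set: T] h.
Proof. exact/measurable_EFinP/(measurable_int _ ih). Qed.

(** A simple function is a combination of indicators of sets of the coarse
    sigma-algebra, on each of which h integrates to zero. *)
Lemma orthogonal_nnsfun (phi : {nnsfun g_sigma_algebraType G >-> R}) :
  (\int[P]_w (phi w * h w)%:E = 0)%E.
Proof.
have mphi y : <<s G >> (phi @^-1` [set y]).
  exact: (measurable_funPTI phi (measurable_set1 y)).
transitivity (\int[P]_w \sum_(y <- finmap.enum_fset (fset_set (range phi)))
    (y%:E * ((h w)%:E * (\1_(phi @^-1` [set y]) w)%:E)))%E.
  apply: eq_integral => w _.
  rewrite [phi w]fimfunE fsbig_finite; last exact: fimfunP.
  rewrite mulr_suml -sumEFin; apply: eq_bigr => y _.
  by rewrite -!EFinM mulrA mulrAC.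
have i1 y : P.-integrable [set: T]
    (fun w => ((h w)%:E * (\1_(phi @^-1` [set y]) w)%:E))%E.
  apply: (le_integrable measurableT _ _ ih).
    apply/measurable_EFinP/measurable_funM => //.
    apply: measurable_indic; exact: GM.
  move=> w _; rewrite -EFinM !abse_EFin lee_fin normrM ler_piMr //.
  by rewrite indicE; case: (_ \in _); rewrite ?normr1 ?normr0.
rewrite integral_sum //; last by move=> y; exact: integrableZl.
rewrite big1 // => y _; rewrite integralZl //.
rewrite (_ : \int[P]_w _ = \int[P]_(w in phi @^-1` [set y]) (h w)%:E)%E.
  by rewrite h0 // mule0.
by rewrite [RHS]integral_mkcond; apply: eq_integral => w _; rewrite epatch_indic.
Qed.

(** Simple functions measurable for the coarse sigma-algebra increase to Z,
    and |Z h| dominates their products with h. *)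
Lemma orthogonal_ge0 (Z : T -> R) : (forall w, 0 <= Z w) ->
  measurable_fun [set: g_sigma_algebraType G] Z ->
  P.-integrable [set: T] (fun w => (Z w * h w)%:E) ->
  (\int[P]_w (Z w * h w)%:E = 0)%E.
Proof.
move=> Z0 mZ iZh.
have mZ' : measurable_fun [set: g_sigma_algebraType G] (EFin \o Z).
  exact/measurable_EFinP.
have Z0' w : setT w -> (0 <= (EFin \o Z) w)%E by rewrite lee_fin.
pose phi := nnsfun_approx measurableT mZ'.
have phiZ n w : phi n w <= Z w.
  rewrite /phi nnsfun_approxE -lee_fin.
  by apply: (@le_approx _ (g_sigma_algebraType G) _ setT (EFin \o Z)) => // x _;
    rewrite lee_fin.
have [|||||_ _] := @dominated_convergence _ T R P setT measurableT
  (fun n w => (phi n w * h w)%:E) (fun w => (Z w * h w)%:E)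
  (fun w => `|(Z w * h w)%:E|)%E.
- move=> n; apply/measurable_EFinP/measurable_funM => //.
  apply: measurable_fun_coarse; exact: measurable_funPT.
- exact: measurable_int iZh.
- apply: aeW => w _ /=.
  have := @cvgeZr _ \oo R (fun n => (phi n w)%:E) (Z w)%:E (h w)%:E isT.
  apply; exact: (@cvg_nnsfun_approx _ _ _ _ measurableT _ mZ' Z0' w I).
- exact: integrable_abse.
- apply: aeW => w n _; rewrite !abse_EFin lee_fin !normrM ler_wpM2r //.
  by rewrite !ger0_norm.
rewrite (_ : [sequence _]_n = cst 0%E); last first.
  by apply/funext => n; rewrite /= orthogonal_nnsfun.
by move=> lim; apply/esym; apply: cvg_unique lim => //; exact: cvg_cst.
Qed.

Lemma orthogonal_centered (Z : T -> R) :
  measurable_fun [set: g_sigma_algebraType G] Z ->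
  P.-integrable [set: T] (fun w => (Z w * h w)%:E) ->
  (\int[P]_w (Z w * h w)%:E = 0)%E.
Proof.
move=> mZ iZh.
have mZ' : measurable_fun [set: T] Z by exact: measurable_fun_coarse.
have part (Y : T -> R) : (forall w, 0 <= Y w) -> (forall w, Y w <= `|Z w|) ->
    measurable_fun [set: g_sigma_algebraType G] Y ->
    P.-integrable [set: T] (fun w => (Y w * h w)%:E).
  move=> Y0 YZ mY; apply: le_integrable iZh => //.
    apply/measurable_EFinP/measurable_funM => //; exact: measurable_fun_coarse.
  move=> w _; rewrite !abse_EFin lee_fin !normrM ler_wpM2r //.
  by rewrite (ger0_norm (Y0 w)).
have mp : measurable_fun [set: g_sigma_algebraType G] Z^\+.
  exact: measurable_funrpos.
have mn : measurable_fun [set: g_sigma_algebraType G] Z^\-.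
  exact: measurable_funrneg.
have ip : P.-integrable [set: T] (fun w => (Z^\+ w * h w)%:E).
  by apply: part => // w; rewrite /funrpos ge_max ler_norm normr_ge0.
have iN : P.-integrable [set: T] (fun w => (Z^\- w * h w)%:E).
  by apply: part => // w; rewrite /funrneg ge_max ler_normr lexx orbT normr_ge0.
transitivity (\int[P]_w ((Z^\+ w * h w)%:E - (Z^\- w * h w)%:E))%E.
  apply: eq_integral => w _; rewrite -EFinB -mulrBl; congr (_ * _)%:E.
  by rewrite -[in LHS](funrposBneg Z).
by rewrite integralB // !orthogonal_ge0 // sube0.
Qed.
End CenteredNoise.
End Orthogonality.

(** * Measurability of random vectors by coordinates *)

Section VectorMeasurability.
Context (R : realType) (d : nat).

(** Measurability by coordinates is stable under the linear operations of the
    recursion by the corresponding facts on real functions. *)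
Definition coord_measurable (disp : measure_display) (T : measurableType disp)
    (X : T -> 'rV[R]_d) : Prop :=
  forall i, measurable_fun [set: T] (fun w => X w ord0 i).

Section Borel.
Context (disp : measure_display) (T : measurableType disp).
Implicit Types X Y : T -> 'rV[R]_d.

Lemma random_vector_coord X : random_vector X -> coord_measurable X.
Proof.
move=> mX i; apply: (measurability _ (RGenOpens.measurableE R)).
move=> _ [_ [a [b ->]] <-]; apply: mX.
exists ((fun u : 'rV[R]_d => u ord0 i) @^-1` `]a, b[%classic); last by [].
have /continuousP co : continuous (fun u : 'rV[R]_d => u ord0 i).
  exact: coord_continuous.
by apply: sub_sigma_algebra; exact/co/interval_open.
Qed.

Definition rat_box (q : 'rV[rat]_d * rat) : set 'rV[R]_d :=
  [set y | forall i, `|y ord0 i - ratr (q.1 ord0 i)| < ratr q.2].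

(** Second countability of the space, in the form that turns the preimage of
    an open set into a countable union of events on coordinates. *)
Lemma open_rat_box (V : set 'rV[R]_d) : open V ->
  V = \bigcup_q [set y | rat_box q y /\ rat_box q `<=` V].
Proof.
move=> oV; apply/seteqP; split=> [x Vx|x [q _ [qx]]]; last by apply.
have /nbhs_ballP [e /= e0 eV] := open_nbhs_nbhs (conj oV Vx).
have [r] := @rat_in_itvoo R 0 (e / 2) (divr_gt0 e0 (ltr0Sn _ 1)).
rewrite in_itv /= => /andP[r0 re].
have ap i : exists q : rat, `|x ord0 i - ratr q| < ratr r.
  have [|q] := @rat_in_itvoo R (x ord0 i - ratr r) (x ord0 i + ratr r).
    by rewrite ltrBlDr -addrA ltrDl addr_gt0.
  rewrite in_itv /= => /andP[q1 q2]; exists q; rewrite ltr_norml; lra.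
have [q qE] := choice ap.
exists (\row_i q i, r) => //; split=> [i /=|y qy]; first by rewrite mxE.
apply: eV; split=> // i j; rewrite ord1 /ball /=.
have := qE j; have := qy j; rewrite /= mxE !ltr_norml; lra.
Qed.

Lemma continuous_measurable_comp (f : 'rV[R]_d -> R) X :
  continuous f -> coord_measurable X -> measurable_fun [set: T] (f \o X).
Proof.
move=> /continuousP cf mX; apply: (measurability _ (RGenOpens.measurableE R)).
move=> _ [_ [a [b ->]] <-]; set U := `]a, b[%classic.
have oU : open U by exact: interval_open.
rewrite setTI comp_preimage (open_rat_box (cf _ oU)).
rewrite preimage_bigcup; apply: countable_bigcupT_measurable => // q.
have [qU|nqU] := pselect (rat_box q `<=` f @^-1` U); last first.
  rewrite (_ : _ @^-1` _ = set0) //; apply/seteqP; split=> // w [].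
  by move=> _ /nqU.
rewrite (_ : _ @^-1` _ = \bigcap_(i : 'I_d)
    [set w | `|X w ord0 i - ratr (q.1 ord0 i)| < ratr q.2]); last first.
  apply/seteqP; split=> w /= h; first by move=> i _; exact: h.1.
  by split=> // i; exact: h.
apply: fin_bigcap_measurable => [|i _]; first exact: finite_finset.
rewrite -[X in measurable X]setTI.
have mn : measurable_fun setT (fun w => `|X w ord0 i - ratr (q.1 ord0 i)|).
  by apply: measurableT_comp => //; exact: measurable_funB.
have := measurable_fun_ltr mn (measurable_cst (ratr q.2 : R)).
by move=> /(_ measurableT [set true]); apply.
Qed.

Lemma coord_measurableD X Y : coord_measurable X -> coord_measurable Y ->
  coord_measurable (fun w => X w + Y w).
Proof.
move=> mX mY i; under eq_fun do rewrite mxE.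
exact: measurable_funD.
Qed.

Lemma coord_measurableZ c X : coord_measurable X ->
  coord_measurable (fun w => c *: X w).
Proof.
move=> mX i; under eq_fun do rewrite mxE.
by apply: measurable_funM => //; exact: measurable_cst.
Qed.

Lemma coord_measurableB X Y : coord_measurable X -> coord_measurable Y ->
  coord_measurable (fun w => X w - Y w).
Proof.
move=> mX mY i; under eq_fun do rewrite !mxE.
exact: measurable_funB.
Qed.

Lemma coord_measurable_cst u : coord_measurable (fun _ : T => u).
Proof. by move=> i; exact: measurable_cst. Qed.

Lemma measurable_dotp X Y : coord_measurable X -> coord_measurable Y ->
  measurable_fun [set: T] (fun w => dotp (X w) (Y w)).
Proof.
by move=> mX mY; apply: measurable_sum => i; exact: measurable_funM.
Qed.

End Borel.
End VectorMeasurability.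

(** * Conditional expectation and square-integrable noise *)

Section ConditionalExpectation.
Context (R : realType) (disp : measure_display) (T : measurableType disp)
  (P : probability T R) (G : set (set T)).
Hypothesis GM : <<s G >> `<=` measurable.

(** Only the positive part of the version Y matters: Y integrates to E[X],
    and discarding its negative part increases the integral. *)
Lemma condexp_le (X b : T -> R) (Y : T -> \bar R) :
  is_condexp P <<s G >> (EFin \o X) Y ->
  (forall w, 0 <= b w) -> measurable_fun [set: T] b ->
  {ae P, forall w, (Y w <= (b w)%:E)%E} ->
  (\int[P]_w (X w)%:E <= \int[P]_w (b w)%:E)%E.
Proof.
move=> [mY intY] b0 mb Yb.
have mY' : measurable_fun [set: T] Y.
  by move=> _ B mB; rewrite setTI; apply: GM; exact: mY.
have GT : <<s G >> [set: T] by exact: (@measurableT _ (g_sigma_algebraType G)).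
rewrite -(intY _ GT) integralE -[leRHS]sube0.
apply: leeB; last by apply: integral_ge0.
apply: ae_ge0_le_integral => //.
- exact: measurable_funepos.
- by move=> w _; rewrite lee_fin.
- exact/measurable_EFinP.
- apply: filterS Yb => w Yb _.
  by rewrite funeposE ge_max Yb lee_fin b0.
Qed.

Lemma condexp_centered (X Y : T -> R) :
  is_condexp P <<s G >> (EFin \o X) (EFin \o Y) ->
  P.-integrable [set: T] (EFin \o X) -> P.-integrable [set: T] (EFin \o Y) ->
  forall A, <<s G >> A -> (\int[P]_(w in A) (X w - Y w)%:E = 0)%E.
Proof.
move=> [_ intXY] iX iY A GA; have mA := GM GA.
have iX' : P.-integrable A (EFin \o X) by apply: integrableS iX.
have iY' : P.-integrable A (EFin \o Y) by apply: integrableS iY.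
under eq_integral do rewrite EFinB.
rewrite integralB //; have /= -> := intXY _ GA.
by rewrite subee // integrable_fin_num.
Qed.

End ConditionalExpectation.

Section SquareIntegrable.
Context (R : realType) (d : nat) (disp : measure_display)
  (T : measurableType disp) (P : probability T R).
Implicit Types X Y : T -> 'rV[R]_d.

Lemma integrable_le (X Y : T -> R) : measurable_fun [set: T] X ->
  (forall w, `|X w| <= Y w) -> P.-integrable [set: T] (EFin \o Y) ->
  P.-integrable [set: T] (EFin \o X).
Proof.
move=> mX XY; apply: le_integrable => //; first exact/measurable_EFinP.
move=> w _; rewrite !abse_EFin lee_fin; exact: le_trans (XY w) (ler_norm _).
Qed.

Lemma sqr_coord_le_dotp (u : 'rV[R]_d) i : u ord0 i ^+ 2 <= dotp u u.
Proof.
rewrite /dotp (bigD1 i) //= -expr2 lerDl sumr_ge0 // => j _.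
by rewrite -expr2 sqr_ge0.
Qed.

Lemma norm_coordM_le (u v : 'rV[R]_d) i j :
  `|u ord0 i * v ord0 j| <= dotp u u + dotp v v.
Proof.
apply: le_trans (lerD (sqr_coord_le_dotp u i) (sqr_coord_le_dotp v j)).
set a := u _ _; set b := v _ _; rewrite ler_norml.
have := sqr_ge0 (a - b); have := sqr_ge0 (a + b); have := sqr_ge0 a; have := sqr_ge0 b.
by move=> *; apply/andP; split; lra.
Qed.

Lemma integrable_coordM X Y i j : coord_measurable X -> coord_measurable Y ->
  P.-integrable [set: T] (fun w => (dotp (X w) (X w))%:E) ->
  P.-integrable [set: T] (fun w => (dotp (Y w) (Y w))%:E) ->
  P.-integrable [set: T] (fun w => (X w ord0 i * Y w ord0 j)%:E).
Proof.
move=> mX mY iX iY.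
apply: (@integrable_le _ (fun w => dotp (X w) (X w) + dotp (Y w) (Y w))).
- exact: measurable_funM.
- by move=> w; exact: norm_coordM_le.
- exact: integrableD iX iY.
Qed.

Lemma integrable_coord X i : coord_measurable X ->
  P.-integrable [set: T] (fun w => (dotp (X w) (X w))%:E) ->
  P.-integrable [set: T] (fun w => (X w ord0 i)%:E).
Proof.
move=> mX iX; apply: (@integrable_le _ (fun w => 1 + dotp (X w) (X w))) => //.
  move=> w; have := sqr_coord_le_dotp (X w) i.
  set a := X w _ _; rewrite ler_norml.
  have := sqr_ge0 (a - 1); have := sqr_ge0 (a + 1); have := sqr_ge0 a.
  by move=> *; apply/andP; split; lra.
have i1 := finite_measure_integrable_cst P (1 : R) measurableT.
exact: (integrableD measurableT i1 iX).
Qed.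

End SquareIntegrable.

(** A single step: g is the sample, m its conditional mean given the
    sigma-algebra generated by G, and W is known before sampling. *)
Section NoisyStep.
Context (R : realType) (d : nat) (disp : measure_display)
  (T : measurableType disp) (P : probability T R) (G : set (set T)).
Hypothesis GM : <<s G >> `<=` measurable.
Let TG := g_sigma_algebraType G.
Variables (g m W : T -> 'rV[R]_d) (s : R).
Hypotheses (mg : coord_measurable g)
  (mm : coord_measurable (m : TG -> _)) (mW : coord_measurable (W : TG -> _))
  (im : P.-integrable [set: T] (fun w => (dotp (m w) (m w))%:E))
  (iW : P.-integrable [set: T] (fun w => (dotp (W w) (W w))%:E))
  (unbiased : forall i,
    P.-integrable [set: T] (fun w => (g w ord0 i)%:E) /\
    is_condexp P <<s G >> (fun w => (g w ord0 i)%:E)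
      (fun w => (m w ord0 i)%:E))
  (s0 : 0 <= s)
  (noise : exists2 Y : T -> \bar R,
    is_condexp P <<s G >> (fun w => (dotp (g w - m w) (g w - m w))%:E) Y &
    {ae P, forall w, (Y w <= (s * dotp (m w) (m w))%:E)%E}).

Let mmT : coord_measurable m.
Proof. by move=> i; apply: (measurable_fun_coarse GM); exact: mm. Qed.

Let mWT : coord_measurable W.
Proof. by move=> i; apply: (measurable_fun_coarse GM); exact: mW. Qed.

Let mn : coord_measurable (fun w => g w - m w).
Proof. exact: coord_measurableB. Qed.

Lemma noise_le : (\int[P]_w (dotp (g w - m w) (g w - m w))%:E
  <= s%:E * \int[P]_w (dotp (m w) (m w))%:E)%E.
Proof.
have [Y cY Yle] := noise.
rewrite -integralZl //.
apply: (condexp_le GM cY _ _ Yle).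
  by move=> w; rewrite mulr_ge0 ?dotp_ge0.
apply: measurable_funM; first exact: measurable_cst.
exact: measurable_dotp.
Qed.

Lemma integrable_noise :
  P.-integrable [set: T] (fun w => (dotp (g w - m w) (g w - m w))%:E).
Proof.
apply/integrableP; split.
  apply/measurable_EFinP; exact: measurable_dotp.
under eq_integral do rewrite gee0_abs ?lee_fin ?dotp_ge0 //.
apply: le_lt_trans noise_le _.
by apply: lte_mul_pinfty => //; exact: integrable_lty.
Qed.

Lemma integrable_noise_dotp :
  P.-integrable [set: T] (fun w => (dotp (g w - m w) (W w))%:E).
Proof.
rewrite /dotp; under eq_fun do rewrite -sumEFin.
apply: integrable_sum => // i _.
exact: integrable_coordM integrable_noise iW.
Qed.

(** Coordinatewise, n_i = g_i - m_i integrates to zero on every set of the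
    coarse sigma-algebra, and W_i is measurable for it. *)
Lemma noise_orthogonal : (\int[P]_w (dotp (g w - m w) (W w))%:E = 0)%E.
Proof.
rewrite /dotp; under eq_integral do rewrite -sumEFin.
rewrite integral_sum //; last first.
  by move=> i; exact: integrable_coordM integrable_noise iW.
apply: big1 => i _; have [ig cg] := unbiased i.
have imi := integrable_coord i mmT im.
under eq_integral do rewrite mulrC mxE [X in _ + X]mxE.
apply: (orthogonal_centered GM (h := fun w => g w ord0 i - m w ord0 i)).
- exact: integrableB ig imi.
- exact: condexp_centered cg ig imi.
- exact: mW.
- have := integrable_coordM i i mWT mn iW integrable_noise.
  by under eq_fun do rewrite mxE [X in _ + X]mxE.
Qed.

Lemma expected_decrease (q c : R) (V V' : T -> R) : 0 <= c ->
  P.-integrable [set: T] (EFin \o V) ->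
  measurable_fun [set: T] V' -> (forall w, 0 <= V' w) ->
  (forall w, V' w <= q * V w
     + c * (dotp (g w - m w) (g w - m w) - s * dotp (m w) (m w))
     + dotp (g w - m w) (W w)) ->
  P.-integrable [set: T] (EFin \o V') /\
  (\int[P]_w (V' w)%:E <= q%:E * \int[P]_w (V w)%:E)%E.
Proof.
move=> c0 iV mV' V'0 step.
have iN := integrable_noise.
have iD := integrable_noise_dotp.
pose U w := c * (dotp (g w - m w) (g w - m w) - s * dotp (m w) (m w)).
have iB : P.-integrable [set: T] (fun w =>
  (dotp (g w - m w) (g w - m w))%:E - s%:E * (dotp (m w) (m w))%:E)%E.
  by apply: integrableB => //; exact: integrableZl.
have iU : P.-integrable [set: T] (EFin \o U) by exact: integrableZl iB.
have iqV : P.-integrable [set: T] (fun w => (q * V w)%:E) by exact: integrableZl iV.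
have iS : P.-integrable [set: T] (fun w => (q * V w)%:E + (U w)%:E)%E.
  exact: integrableD.
have iR : P.-integrable [set: T]
    (fun w => (q * V w)%:E + (U w)%:E + (dotp (g w - m w) (W w))%:E)%E.
  exact: integrableD.
have iV' : P.-integrable [set: T] (EFin \o V').
  by apply: integrable_le iR => // w; rewrite ger0_norm //; exact: step.
split=> //.
apply: (@le_trans _ _ (\int[P]_w
    ((q * V w)%:E + (U w)%:E + (dotp (g w - m w) (W w))%:E))%E).
  by apply: le_integral => // w _; exact: step.
rewrite integralD // integralD // noise_orthogonal adde0.
rewrite [X in (X + _)%E](_ : _ = q%:E * \int[P]_w (V w)%:E)%E; last first.
  by rewrite -integralZl.
rewrite -[leRHS]adde0 leeD2l //.
rewrite (_ : \int[P]_w _ = c%:E * \int[P]_w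
  ((dotp (g w - m w) (g w - m w))%:E - s%:E * (dotp (m w) (m w))%:E))%E; last first.
  by rewrite -integralZl.
rewrite mule_ge0_le0 ?lee_fin // integralB //; last exact: integrableZl.
rewrite integralZl // sube_le0 //; exact: noise_le.
Qed.

End NoisyStep.

(** * The recursion and its measurability *)

Lemma step_size_bounds (R : realType) (mu L s ta : R) :
  0 < mu -> mu < L -> 0 <= s -> 0 < ta ->
  ta <= 1 / (1 + s) * Num.sqrt (mu / L) ->
  ta < 1 /\ ta ^+ 2 * (1 + s) ^+ 2 * L <= mu.
Proof.
move=> mu0 muL s0 ta0 tale.
have L0 : 0 < L by lra.
have s1 : 0 < 1 + s by lra.
have tas : ta * (1 + s) <= Num.sqrt (mu / L).
  by rewrite -ler_pdivlMr // mulrC -[_^-1]mul1r.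
have q1 : mu / L < 1 by rewrite ltr_pdivrMr // mul1r.
have q0 : 0 <= mu / L by rewrite divr_ge0 ?ltW.
split.
  have : Num.sqrt (mu / L) < 1 by rewrite -sqrtr1 ltr_sqrt.
  by apply: le_lt_trans; apply: le_trans tas; nra.
have : (ta * (1 + s)) ^+ 2 <= mu / L.
  rewrite -[leRHS](sqr_sqrtr q0) ler_pXn2r ?nnegrE ?sqrtr_ge0 //.
  by rewrite mulr_ge0 ?ltW.
rewrite ler_pdivlMr // => h.
by rewrite -exprMn.
Qed.

Section Recursion.
Context (R : realType) (d : nat) (T : Type) (mu ta alpha beta : R)
  (g x xp v : nat -> T -> 'rV[R]_d).
Hypotheses (ta_gt0 : 0 < ta) (ta_lt1 : ta < 1)
  (alphaE : alpha = ta / (1 - ta))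
  (recursion : shangpp mu ta alpha beta g x xp v).

Lemma shangpp_xS k w : x k.+1 w = (1 + ta)^-1 *: (xp k w + ta *: v k w).
Proof.
have t1 : 1 + ta != 0 by rewrite gt_eqF // addr_gt0.
have t0 : ta != 0 by rewrite gt_eqF.
apply/rowP => i; have /rowP /(_ i) := shangpp_x recursion k w.
rewrite !mxE => h; apply: (mulfI t1); rewrite mulrA divff // mul1r.
have : ta * (ta^-1 * (x k.+1 w ord0 i - xp k w ord0 i))
  = ta * (v k w ord0 i - x k.+1 w ord0 i) by rewrite h.
rewrite mulrA divff // mul1r; lra.
Qed.

Lemma shangpp_coupling k w :
  x k.+1 w - xp k w = ta *: (v k w - x k.+1 w).
Proof.
by rewrite -(shangpp_x recursion) scalerA divff ?scale1r // gt_eqF.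
Qed.

Lemma shangpp_vS k w : v k.+1 w =
  (1 - ta) *: v k w + ta *: x k.+1 w - (ta / mu) *: g k.+1 w.
Proof.
have t1 : 1 - ta != 0 by rewrite gt_eqF // subr_gt0.
have t0 : ta != 0 by rewrite gt_eqF.
apply/rowP => i; have /rowP /(_ i) := shangpp_v recursion k w.
rewrite alphaE !mxE invf_div => h.
have {h} : ta * ((1 - ta) / ta * (v k.+1 w ord0 i - v k w ord0 i)) =
  ta * (x k.+1 w ord0 i - v k.+1 w ord0 i - mu^-1 * g k.+1 w ord0 i) by rewrite h.
rewrite mulrA mulrCA divff // mulr1; lra.
Qed.

End Recursion.

Section RecursionMeasurability.
Context (R : realType) (d : nat) (disp : measure_display)
  (T : measurableType disp) (mu ta alpha beta : R)
  (g x xp v : nat -> T -> 'rV[R]_d).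
Hypotheses (ta_gt0 : 0 < ta) (ta_lt1 : ta < 1)
  (alphaE : alpha = ta / (1 - ta))
  (recursion : shangpp mu ta alpha beta g x xp v)
  (x0_meas : coord_measurable (x 0%N)).

(** The samples up to index n determine x_n^+, v_n and x_{n+1}.  The
    sigma-algebra on T is left arbitrary so that the lemma applies to the full one as well
    as to the one generated by the history. *)
Lemma shangpp_measurable n :
  (forall j, (j <= n)%N -> coord_measurable (g j)) ->
  [/\ coord_measurable (xp n), coord_measurable (v n)
    & coord_measurable (x n.+1)].
Proof.
have xpE k : xp k = (fun w => x k w - (ta * beta) *: g k w).
  by apply/funext => w; exact: shangpp_xp recursion k w.
have xE k : x k.+1 = (fun w => (1 + ta)^-1 *: (xp k w + ta *: v k w)).
  by apply/funext => w; exact: shangpp_xS ta_gt0 recursion k w.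
have vE k : v k.+1 = (fun w => (1 - ta) *: v k w + ta *: x k.+1 w
    - (ta / mu) *: g k.+1 w).
  by apply/funext => w; exact: shangpp_vS ta_gt0 ta_lt1 alphaE recursion k w.
have xSm k : coord_measurable (xp k) -> coord_measurable (v k) ->
    coord_measurable (x k.+1).
  move=> mxp mv; rewrite xE; apply: coord_measurableZ.
  by apply: coord_measurableD => //; exact: coord_measurableZ.
have xpm k : coord_measurable (x k) -> coord_measurable (g k) ->
    coord_measurable (xp k).
  move=> mx mg; rewrite xpE.
  by apply: coord_measurableB => //; exact: coord_measurableZ.
elim: n => [|n IH] mg.
  have mxp : coord_measurable (xp 0%N) by apply: xpm => //; exact: mg.
  have mv : coord_measurable (v 0%N).
    rewrite (_ : v 0%N = x 0%N) //; apply/funext => w.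
    by rewrite (shangpp_init recursion).
  by split=> //; exact: xSm.
have [|mxp mv mx] := IH; first by move=> j jn; apply: mg; exact: leqW.
have mxp' : coord_measurable (xp n.+1) by apply: xpm => //; exact: mg.
have mv' : coord_measurable (v n.+1).
  rewrite vE; apply: coord_measurableB; last by apply: coord_measurableZ; exact: mg.
  by apply: coord_measurableD; exact: coord_measurableZ.
by split=> //; exact: xSm.
Qed.

End RecursionMeasurability.

(** * Decay of the Lyapunov function in expectation *)

Section Main.
Context (R : realType) (d : nat) (disp : measure_display)
  (T : measurableType disp) (P : probability T R) (mu L sigma : R).
Hypotheses (mu_gt0 : 0 < mu) (mu_lt_L : mu < L).
Context (f : 'rV[R]_d -> R).
Hypothesis f_class : strongly_convex_smooth mu L f.
Context (xstar : 'rV[R]_d).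
Hypothesis xstar_min : forall y : 'rV[R]_d, f xstar <= f y.
Context (ta alpha beta : R).
Hypotheses (ta_gt0 : 0 < ta)
  (ta_le : ta <= 1 / (1 + sigma ^+ 2) * Num.sqrt (mu / L))
  (alphaE : alpha = ta / (1 - ta))
  (betaE : beta = ta / (mu / (1 + sigma ^+ 2))).
Context (g x xp v : nat -> T -> 'rV[R]_d).
Hypotheses (x0_random : random_vector (x 0%N))
  (g_random : forall k : nat, random_vector (g k))
  (recursion : shangpp mu ta alpha beta g x xp v)
  (g_unbiased : unbiased_gradients P f x g)
  (g_mns : mns P sigma f x g).

Definition lyapunov k w :=
  f (xp k w) - f xstar + mu / 2 * dotp (v k w - xstar) (v k w - xstar).

(** Generators of [history], needed to form the measurable space of the events
    known before the sample of index k. *)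
Definition history_gen k : set (set T) :=
  sigma_of (x 0%N) `|` \bigcup_(j in [set j | (j < k)%N]) sigma_of (g j).

Let L_gt0 : 0 < L. Proof. exact: lt_trans mu_lt_L. Qed.

Let ta_lt1 : ta < 1.
Proof. by have [] := step_size_bounds mu_gt0 mu_lt_L (sqr_ge0 sigma) ta_gt0 ta_le. Qed.

Lemma history_sub k : <<s history_gen k >> `<=` measurable.
Proof.
apply: smallest_sub; first exact: sigma_algebra_measurable.
by move=> A [|[j _]]; [exact: x0_random|exact: g_random].
Qed.

Lemma history_x0 k : coord_measurable (x 0%N : g_sigma_algebraType (history_gen k) -> _).
Proof.
by apply: random_vector_coord => A xA; apply: sub_sigma_algebra; left.
Qed.

Lemma history_g k j : (j < k)%N ->
  coord_measurable (g j : g_sigma_algebraType (history_gen k) -> _).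
Proof.
move=> jk; apply: random_vector_coord => A gA; apply: sub_sigma_algebra; right.
by exists j.
Qed.

Lemma lyapunov_ge0 k w : 0 <= lyapunov k w.
Proof.
by rewrite addr_ge0 ?subr_ge0 // mulr_ge0 ?dotp_ge0 // divr_ge0 ?ltW.
Qed.

Let f_continuous : continuous f.
Proof. by move=> y; apply: differentiable_continuous; exact: scs_differentiable f_class y. Qed.

Lemma measurable_lyapunov k : measurable_fun [set: T] (lyapunov k).
Proof.
have [|mxp mv _] := shangpp_measurable ta_gt0 ta_lt1 alphaE recursion
  (random_vector_coord x0_random) (n := k).
  by move=> j _; exact/random_vector_coord/g_random.
apply: measurable_funD.
  apply: measurable_funB; last exact: measurable_cst.
  exact: (continuous_measurable_comp f_continuous mxp).
apply: measurable_funM; first exact: measurable_cst.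
by apply: measurable_dotp; apply: coord_measurableB => //; exact: coord_measurable_cst.
Qed.

(** Integrability is part of the conclusion because the next step starts from
    it. *)
Lemma lyapunov_contraction k : P.-integrable [set: T] (EFin \o lyapunov k) ->
  P.-integrable [set: T] (EFin \o lyapunov k.+1) /\
  (\int[P]_w (lyapunov k.+1 w)%:E <= (1 - ta)%:E * \int[P]_w (lyapunov k w)%:E)%E.
Proof.
move=> iV.
have [_ kL] := step_size_bounds mu_gt0 mu_lt_L (sqr_ge0 sigma) ta_gt0 ta_le.
pose GG := history_gen k.+1.
have GM : <<s GG >> `<=` measurable := @history_sub k.+1.
pose TG := g_sigma_algebraType GG.
have [mxp mv mx] : [/\ coord_measurable (xp k : TG -> _),
    coord_measurable (v k : TG -> _) & coord_measurable (x k.+1 : TG -> _)].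
  apply: (@shangpp_measurable R d _ TG mu ta alpha beta g x xp v) => //.
  - exact: history_x0.
  - by move=> j jk; exact: history_g.
pose m w := grad f (x k.+1 w).
pose c1 := ta ^+ 2 / mu * (1 - sigma ^+ 2).
pose W w := c1 *: m w
  - ta *: (x k.+1 w - xstar + (1 - ta) *: (v k w - x k.+1 w)).
(* A version of a conditional expectation is measurable for the history. *)
have mm : coord_measurable (m : TG -> _).
  move=> i; have [_ [mi _]] := g_unbiased k.+1 i.
  apply/measurable_EFinP => _ B mB; rewrite setTI; exact: mi.
have mW : coord_measurable (W : TG -> _).
  apply: coord_measurableB; first exact: coord_measurableZ.
  apply/coord_measurableZ/coord_measurableD.
    by apply: coord_measurableB => //; exact: coord_measurable_cst.
  by apply/coord_measurableZ/coord_measurableB.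
have [C C0 dom] := lyapunov_dominates c1 (1 - ta) mu_gt0 L_gt0 f_class
  (ltW ta_gt0) (ltW ta_lt1).
have iCV : P.-integrable [set: T] (EFin \o (fun w => C * lyapunov k w)).
  exact: integrableZl iV.
have dom' w := dom xstar _ _ _ xstar_min (shangpp_coupling ta_gt0 recursion k w).
have coarse (X : T -> 'rV[R]_d) : coord_measurable (X : TG -> _) -> coord_measurable X.
  by move=> mX i; apply: (measurable_fun_coarse GM); exact: mX.
have im : P.-integrable [set: T] (fun w => (dotp (m w) (m w))%:E).
  apply: integrable_le iCV; first by apply: measurable_dotp; exact: coarse.
  by move=> w; rewrite ger0_norm ?dotp_ge0 //; have [] := dom' w.
have iW : P.-integrable [set: T] (fun w => (dotp (W w) (W w))%:E).
  apply: integrable_le iCV; first by apply: measurable_dotp; exact: coarse.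
  by move=> w; rewrite ger0_norm ?dotp_ge0 //; have [] := dom' w.
apply: (expected_decrease GM (g := g k.+1) (m := m) (W := W) (s := sigma ^+ 2)
  (c := ta ^+ 2 / mu) _ mm mW im iW _ _ _ _ iV) => //.
- exact/random_vector_coord/g_random.
- exact: sqr_ge0.
- have [Y cY Yle] := g_mns k.+1; exists Y.
    by under eq_fun do rewrite -sqr_enorm.
  by apply: filterS Yle => w; rewrite sqr_enorm.
- by rewrite divr_ge0 ?sqr_ge0 // ltW.
- exact: measurable_lyapunov.
- exact: lyapunov_ge0.
- move=> w; rewrite /lyapunov (shangpp_xp recursion) (shangpp_vS ta_gt0 ta_lt1 alphaE recursion).
  rewrite (_ : ta * beta = ta ^+ 2 / mu * (1 + sigma ^+ 2)).
    exact: lyapunov_step (ltW ta_lt1) kL xstar_min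
      (shangpp_coupling ta_gt0 recursion k w) (erefl (m w)).
  by rewrite betaE; field; rewrite !gt_eqF // ltr_wpDr ?sqr_ge0.
Qed.

Lemma lyapunov_decay k : P.-integrable [set: T] (EFin \o lyapunov 0) ->
  P.-integrable [set: T] (EFin \o lyapunov k) /\
  (\int[P]_w (lyapunov k w)%:E
    <= ((1 - ta) ^+ k)%:E * \int[P]_w (lyapunov 0 w)%:E)%E.
Proof.
move=> i0; elim: k => [|k [ik le_k]]; first by split=> //; rewrite expr0 mul1e.
have [ik1 le_k1] := lyapunov_contraction ik; split=> //.
apply: le_trans le_k1 _; rewrite exprS EFinM -muleA.
by apply: lee_wpmul2l => //; rewrite lee_fin subr_ge0 ltW.
Qed.

End Main.

Unset Implicit Arguments.

Theorem theorem2p2 (R : realType) (d : nat) (disp : measure_display)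
  (T : measurableType disp) (P : probability T R)
  (P_complete : measure_is_complete P)
  (mu L sigma : R) (mu_gt0 : 0 < mu) (mu_lt_L : mu < L) (sigma_ge0 : 0 <= sigma)
  (f : 'rV[R]_d -> R) (f_class : strongly_convex_smooth mu L f)
  (xstar : 'rV[R]_d) (xstar_min : forall y : 'rV[R]_d, f xstar <= f y)
  (ta alpha beta : R) (ta_gt0 : 0 < ta)
  (ta_le : ta <= 1 / (1 + sigma ^+ 2) * Num.sqrt (mu / L))
  (alphaE : alpha = ta / (1 - ta))
  (betaE : beta = ta / (mu / (1 + sigma ^+ 2)))
  (g x xp v : nat -> T -> 'rV[R]_d)
  (x0_random : random_vector (x 0%N))
  (g_random : forall k : nat, random_vector (g k))
  (recursion : shangpp mu ta alpha beta g x xp v)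
  (g_unbiased : unbiased_gradients P f x g)
  (g_mns : mns P sigma f x g) :
  forall k : nat,
    ('E_P[fun w => (f (xp k.+1 w) - f xstar
                    + mu / 2 * enorm (v k.+1 w - xstar) ^+ 2)%R]
     <= ((1 - ta) ^+ k.+1)%R%:E *
        'E_P[fun w => (f (xp 0%N w) - f xstar
                       + mu / 2 * enorm (v 0%N w - xstar) ^+ 2)%R])%E.
Proof.
move=> k.
have [ta_lt1 _] := step_size_bounds mu_gt0 mu_lt_L (sqr_ge0 sigma) ta_gt0 ta_le.
pose V := lyapunov mu f xstar xp v.
have VE n : (fun w => f (xp n w) - f xstar
    + mu / 2 * enorm (v n w - xstar) ^+ 2) = V n.
  by apply/funext => w; rewrite sqr_enorm.
rewrite !VE unlock.
have V0 n w : 0 <= V n w by exact: lyapunov_ge0.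
have mV n : measurable_fun [set: T] (V n).
  exact: (measurable_lyapunov mu_gt0 mu_lt_L f_class xstar ta_gt0 ta_le alphaE
    x0_random g_random recursion).
have [fin|] := ltP (\int[P]_w (V 0%N w)%:E)%E +oo%E.
  have i0 : P.-integrable [set: T] (EFin \o V 0%N).
    apply/integrableP; split; first exact/measurable_EFinP.
    by under eq_integral do rewrite gee0_abs ?lee_fin ?V0 //.
  by have [] := lyapunov_decay mu_gt0 mu_lt_L f_class xstar_min ta_gt0 ta_le alphaE
    betaE x0_random g_random recursion g_unbiased g_mns k.+1 i0.
rewrite leye_eq => /eqP ->.
rewrite gt0_muley ?leey // lte_fin exprn_gt0 // subr_gt0 //.
Qed.
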